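(* Let $\prec$ be a compatible partial preference on a real vector space $Y$, and let $\sim$ be the equipotency relation generated by $\prec$. Let $\mathcal{U}_\prec$ be the family of all step-linear functions $u:Y\to\mathbb{R}$ such that for all $y,z\in Y$ $$y\prec z\Longrightarrow u(z-y)>0\qquad\text{and}\qquad y\sim z\Longrightarrow u(z-y)=0.$$ Then $\mathcal{U}_\prec$ is nonempty and, moreover, for all $y,z\in Y$ $$y\prec z\iff u(z-y)>0\ \text{ for all }u\in\mathcal{U}_\prec$$ and $$y\sim z\iff u(z-y)=0\ \text{ for all }u\in\mathcal{U}_\prec.$$
   Context: A partial preference on $Y$ is an asymmetric and transitive binary relation $\prec$. The indifference relation generated by $\prec$ is: $y\asymp z$ iff neither $y\prec z$ nor $z\prec y$. The equipotency relation generated by $\prec$ is: $y_1\sim y_2$ iff $\{y\in Y\mid y\asymp y_1\}=\{y\in Y\mid y\asymp y_2\}$. A binary relation $\prec$ is compatible if $y_1\prec y_2$ implies $\lambda y_1\prec\lambda y_2$ and $y_1+y\prec y_2+y$ for all $y\in Y$ and all real $\lambda>0$. Let $\mathcal{L}(Y,\mathbb{R})$ be the vector space of linear functions on $Y$. A family $\mathcal{F}\subset\mathcal{L}(Y,\mathbb{R})$ forms a cortege of linear functions on $Y$ if: (i) $\mathcal{F}$ is ordered by some linear order $\unlhd_{\mathcal{F}}$; (ii) for each $y\in Y$ either the subfamily $\mathcal{F}_y:=\{\phi\in\mathcal{F}\mid\phi(y)\ne0\}$ is empty or $\mathcal{F}_y$ has a least element $\phi_y$ with respect to $\unlhd_{\mathcal{F}}$;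 (iii) for each $\phi\in\mathcal{F}$ there exists $y\in Y$ such that $\phi=\phi_y$. A function $u:Y\to\mathbb{R}$ is step-linear if there is a cortege of linear functions $\mathcal{F}$ such that $u=u_{\mathcal{F}}$, where $u_{\mathcal{F}}(y)=0$ if $\mathcal{F}_y=\varnothing$ and $u_{\mathcal{F}}(y)=\phi_y(y)$ if $\mathcal{F}_y\neq\varnothing$. *)

(* Defs.v *)
From HB Require Import structures.
From mathcomp Require Import all_boot all_order all_algebra.
From mathcomp Require Import boolp classical_sets reals.

Set Implicit Arguments.
Unset Strict Implicit.
Unset Printing Implicit Defensive.

Import Order.TTheory GRing.Theory Num.Theory.

Local Open Scope classical_set_scope.
Local Open Scope ring_scope.

Definition partial_preference (Y : Type) (prec : Y -> Y -> Prop) : Prop :=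
  (forall x y, prec x y -> ~ prec y x) /\
  (forall x y z, prec x y -> prec y z -> prec x z).

Definition indifferent (Y : Type) (prec : Y -> Y -> Prop) (y z : Y) : Prop :=
  ~ prec y z /\ ~ prec z y.

Definition equipotent (Y : Type) (prec : Y -> Y -> Prop) (y1 y2 : Y) : Prop :=
  [set y | indifferent prec y y1] = [set y | indifferent prec y y2].

Definition compatible (R : realType) (Y : lmodType R)
    (prec : Y -> Y -> Prop) : Prop :=
  forall y1 y2, prec y1 y2 ->
    (forall l : R, 0 < l -> prec (l *: y1) (l *: y2)) /\
    (forall y, prec (y1 + y) (y2 + y)).

(* Only the restriction of [le] to [A] is constrained. *)
Definition linear_order_on (T : Type) (A : set T) (le : T -> T -> Prop) : Prop :=
  [/\ forall a, A a -> le a a,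
      forall a b, A a -> A b -> le a b -> le b a -> a = b,
      forall a b c, A a -> A b -> A c -> le a b -> le b c -> le a c &
      forall a b, A a -> A b -> le a b \/ le b a].

Definition is_least (T : Type) (le : T -> T -> Prop) (A : set T) (a : T) : Prop :=
  A a /\ forall b, A b -> le a b.

Section StepLinear.
Variables (R : realType) (Y : lmodType R).
Implicit Types (F : set {linear Y -> R^o}).
Implicit Types (le : {linear Y -> R^o} -> {linear Y -> R^o} -> Prop).

Definition nonvanishing F (y : Y) : set {linear Y -> R^o} :=
  [set phi | F phi /\ phi y != 0].

Definition cortege F le : Prop :=
  [/\ linear_order_on F le,
      forall y, nonvanishing F y = set0 \/
                exists phi, is_least le (nonvanishing F y) phi &
      forall phi, F phi -> exists y, is_least le (nonvanishing F y) phi].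

(* In a cortege, [nonvanishing F y] has a least element as soon as it is
   nonempty, so the default value 0 is taken exactly when it is empty; see
   [step_fun0] and [step_fun_least]. *)
Definition step_fun F le (y : Y) : R :=
  if pselect (exists phi, is_least le (nonvanishing F y) phi) is left h
  then sval (cid h) y else 0.

Lemma step_fun0 F le y : nonvanishing F y = set0 -> step_fun F le y = 0.
Proof.
by move=> F0; rewrite /step_fun F0; case: pselect => // h; case: (cid h) => phi [].
Qed.

Lemma step_fun_least F le y phi : cortege F le ->
  is_least le (nonvanishing F y) phi -> step_fun F le y = phi y.
Proof.
case=> -[_ le_anti _ _] _ _ phi_least; rewrite /step_fun.
case: pselect => [h|[]]; last by exists phi.
case: (cid h) => psi psi_least /=.
suff -> : psi = phi by [].
case: phi_least psi_least => -[Fphi phi0] phi_le [[Fpsi psi0] psi_le].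
by apply: le_anti => //; [apply: psi_le | apply: phi_le].
Qed.

Definition step_linear (u : Y -> R) : Prop :=
  exists F le, cortege F le /\ u = step_fun F le.

Definition step_linear_family (prec : Y -> Y -> Prop) : set (Y -> R) :=
  [set u | step_linear u /\
    forall y z, (prec y z -> 0 < u (z - y)) /\
                (equipotent prec y z -> u (z - y) = 0)].

End StepLinear.

(* Main.v *)
(* Let [P] be the set of [x] with [0 < x] in the preference and [L] the
   set of [h] equipotent to [0]. Then [P] and [L] determine the two relations, [L]
   is a subspace and [P `|` L] is a wedge with lineality space [L]. By Zorn's lemma
   this wedge, enlarged by [- x] when [x] lies outside it, extends to a wedge [W]
   with the same lineality space and [W `|` - W] the whole space, that is, to a
   total preorder. For [e > 0] in this preorder the elements infinitesimal with
   respect to [e] form a subspace; by Zorn's lemma some linear functional vanishes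
   on it and is positive at [e]. Choosing one functional for each such subspace
   and putting larger Archimedean classes first gives a cortege whose step
   function has the sign of the preorder. *)
Require Import Defs.
From HB Require Import structures.
From mathcomp Require Import all_boot all_order all_algebra.
From mathcomp Require Import boolp classical_sets reals.

Set Implicit Arguments.
Unset Strict Implicit.
Unset Printing Implicit Defensive.

Import Order.TTheory GRing.Theory Num.Theory.
Local Open Scope classical_set_scope.
Local Open Scope ring_scope.

(** * Zorn's lemma above a given set *)

(** Zorn's lemma is applied to the sets [X] with [D (A]|[X)]. The empty chain has empty union and is
    settled by [D A], so [chainD] only has to treat nonempty chains. *)
Lemma Zorn_above (T : Type) (D : set (set T)) (A : set T) : D A ->
  (forall F : set (set T), F !=set0 -> F `<=` D -> total_on F subset ->
     D (\bigcup_(X in F) X)) ->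
  exists B, [/\ D B, A `<=` B & forall C, D C -> B `<=` C -> C `<=` B].
Proof.
move=> DA chainD.
have [|X [DX Xmax]] := @Zorn_bigcup T [set X | D (A `|` X)].
  move=> F FD Ftot /=.
  have [->|/set0P[X0 FX0]] := eqVneq F set0; last first.
  - have -> : A `|` \bigcup_(X in F) X = \bigcup_(Z in [set A `|` X | X in F]) Z.
      apply/seteqP; split=> x /=.
      + case=> [Ax|[X FX Xx]]; first by exists (A `|` X0); [exists X0|left].
        by exists (A `|` X); [exists X|right].
      + by case=> _ [X FX <-] [Ax|Xx]; [left|right; exists X].
    apply: chainD; first by exists (A `|` X0); exists X0.
      by move=> _ [X FX <-]; apply: FD.
    move=> _ _ [X FX <-] [Z FZ <-].
    by case: (Ftot X Z FX FZ) => sXZ; [left|right]; apply: setUS.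
  - by rewrite bigcup_set0 setU0.
exists (A `|` X); split=> // C DC sC; apply: contrapT => nsC.
apply: (Xmax C) => /=; last by rewrite setUidr // => a Aa; apply: sC; left.
split=> [x Xx|sCX]; first by apply: sC; right.
by apply: nsC => x /sCX; right.
Qed.

(** * Linear functionals vanishing on a subspace *)

Section Separation.
Variables (R : realType) (Y : lmodType R).

Definition subspace (A : set Y) : Prop :=
  A 0 /\ forall a x y, A x -> A y -> A (a *: x + y).

Lemma subspaceZ A a x : subspace A -> A x -> A (a *: x).
Proof. by move=> [A0 AP] Ax; rewrite -[_ *: _]addr0; apply: AP. Qed.

(** A maximal subspace [H] that contains [A] and avoids [e] has codimension one; [phi] is the
    coordinate along [e] modulo [H]. *)
Lemma exists_linear_functional (A : set Y) (e : Y) : subspace A -> ~ A e ->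
  exists phi : {linear Y -> R^o}, (forall z, A z -> phi z = 0) /\ phi e = 1.
Proof.
move=> subA nAe.
have [//||H [[subH nHe] AH Hmax]] :=
    @Zorn_above Y [set H | subspace H /\ ~ H e] A.
  move=> F [X0 FX0] FD Ftot /=; split; last by move=> [X /FD[]].
  split; first by exists X0 => //; case: (FD _ FX0) => -[].
  move=> a x y [X FX Xx] [Z FZ Zy].
  case: (Ftot _ _ FX FZ) => s.
  - by exists Z => //; apply: (FD _ FZ).1.2 => //; apply: s.
  - by exists X => //; apply: (FD _ FX).1.2 => //; apply: s.
have [H0 HP] := subH.
have He_dec y : exists r : R, H (y - r *: e).
  apply: contrapT => nHy.
  (* If [e = h + r *: y], then [r = 0] puts [e] in [H], and [r != 0] puts [y - r^-1 *: e] in [H].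
     Hence [C] avoids [e], and maximality puts [y] in [H]. *)
  pose C := [set z | exists r h, H h /\ z = h + r *: y].
  have sHC : H `<=` C by move=> h Hh; exists 0, h; rewrite scale0r addr0.
  have DC : subspace C /\ ~ C e.
    split; first split; first exact: sHC.
    - move=> a _ _ [r [h [Hh ->]]] [s [k [Hk ->]]].
      exists (a * r + s), (a *: h + k); split; first exact: HP.
      by rewrite scalerDr scalerA addrACA -scalerDl.
    - move=> [r [h [Hh eE]]]; have [r0|r0] := eqVneq r 0.
        by apply: nHe; rewrite eE r0 scale0r addr0.
      apply: nHy; exists r^-1.
      rewrite eE scalerDr scalerA mulVf // scale1r opprD addrCA subrr addr0.
      by rewrite -scaleNr; apply: subspaceZ.
  apply: nHy; exists 0; rewrite scale0r subr0; apply: (Hmax C) => //.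
  by exists 1, 0; rewrite scale1r add0r.
have uniq y r s : H (y - r *: e) -> H (y - s *: e) -> r = s.
  move=> Hr Hs; apply: subr0_eq; apply: contrapT => /eqP rs.
  apply: nHe; rewrite -[e]scale1r -(mulVf rs) -scalerA.
  apply: subspaceZ => //; have := HP (-1) _ _ Hr Hs.
  by rewrite scaleN1r opprB addrA subrK -scalerBl.
have [f fP] := choice He_dec.
have f_lin : linear_for *:%R (f : Y -> R^o).
  move=> a x y; apply: (uniq (a *: x + y)) => //.
  have := HP a _ _ (fP x) (fP y).
  by rewrite scalerBr scalerA addrACA -opprD -scalerDl.
pose phi : {linear Y -> R^o} :=
  HB.pack_for {linear Y -> R^o} (f : Y -> R^o)
    (GRing.isLinear.Build R Y R^o *:%R f f_lin).
exists phi.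
split=> [z Az|] /=.
  by apply: (uniq z) => //; rewrite scale0r subr0; apply: AH.
by apply: (uniq e) => //; rewrite scale1r subrr.
Qed.

(** * Wedges and their extension to total ones *)

Definition wedge (W : set Y) : Prop :=
  [/\ W 0, forall x y, W x -> W y -> W (x + y) &
      forall l x, 0 <= l -> W x -> W (l *: x)].

Definition adjoin (W : set Y) (y : Y) : set Y :=
  [set z | exists w l, [/\ 0 <= l, W w & z = w + l *: y]].

Lemma sub_adjoin W y : W `<=` adjoin W y.
Proof. by move=> w Ww; exists w, 0; rewrite scale0r addr0. Qed.

Lemma mem_adjoin W y : wedge W -> adjoin W y y.
Proof. by case=> W0 _ _; exists 0, 1; rewrite scale1r add0r. Qed.

Lemma wedge_adjoin W y : wedge W -> wedge (adjoin W y).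
Proof.
move=> [W0 WD WZ]; split; first exact: sub_adjoin.
- move=> _ _ [v [l [l0 Wv ->]]] [w [m [m0 Ww ->]]].
  exists (v + w), (l + m); split; [exact: addr_ge0|exact: WD|].
  by rewrite addrACA -scalerDl.
- move=> k _ k0 [v [l [l0 Wv ->]]]; exists (k *: v), (k * l).
  by split; [exact: mulr_ge0|exact: WZ|rewrite scalerDr scalerA].
Qed.

(** Adding the two representations gives [v + w = - (l + m) *: y]. If [l + m > 0], rescaling puts
    [- y] in [W]; hence [l = m = 0]. *)
Lemma lineality_adjoin W y x : wedge W -> ~ W (- y) ->
  adjoin W y x -> adjoin W y (- x) -> W x /\ W (- x).
Proof.
move=> [W0 WD WZ] nWy [v [l [l0 Wv ->]]] [w [m [m0 Ww vwE]]].
have /eqP lm0 : l + m == 0.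
  apply/eqP; apply: contrapT => /eqP lm_neq0; apply: nWy.
  have -> : - y = (l + m)^-1 *: (v + w); last first.
    by apply: WZ; [rewrite invr_ge0 addr_ge0|exact: WD].
  apply: (@scalerI _ _ (l + m)) => //.
  rewrite scalerA mulfV // scale1r scalerN scalerDl.
  by apply/eqP; rewrite eq_sym -addr_eq0 addrACA -vwE subrr.
move: lm0 => /eqP; rewrite paddr_eq0 // => /andP[/eqP l_eq0 /eqP m_eq0].
by rewrite vwE l_eq0 m_eq0 !scale0r !addr0.
Qed.

(** If a maximal wedge missed both [y] and [- y], adjoining [y] would leave its lineality space
    inside [L], against maximality. *)
Lemma exists_total_wedge (L W0 : set Y) : wedge W0 ->
  (forall x, W0 x -> W0 (- x) -> L x) ->
  exists W, [/\ wedge W, W0 `<=` W, forall x, W x \/ W (- x) &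
                forall x, W x -> W (- x) -> L x].
Proof.
move=> wW0 LW0.
have [//||W [[wW LW] sW0 Wmax]] := @Zorn_above Y
    [set W | wedge W /\ forall x, W x -> W (- x) -> L x] W0.
  move=> F [X0 FX0] FD Ftot /=.
  have common X Z : F X -> F Z -> exists2 V, F V & X `<=` V /\ Z `<=` V.
    move=> FX FZ; case: (Ftot _ _ FX FZ) => s; first by exists Z => //; split.
    by exists X => //; split.
  split; first split.
  - by exists X0 => //; case: (FD _ FX0) => -[].
  - move=> x y [X FX Xx] [Z FZ Zy]; have [V FV [sX sZ]] := common _ _ FX FZ.
    by exists V => //; have [[_ VD _] _] := FD _ FV; apply: VD; [apply: sX|apply: sZ].
  - move=> l x l0 [X FX Xx]; exists X => //.
    by have [[_ _ XZ] _] := FD _ FX; apply: XZ.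
  - move=> x [X FX Xx] [Z FZ Zx]; have [V FV [sX sZ]] := common _ _ FX FZ.
    by apply: (FD _ FV).2; [apply: sX|apply: sZ].
exists W; split=> // y; apply: contrapT => /not_orP[nWy nWNy].
apply: nWy; apply: (Wmax (adjoin W y)); last exact: mem_adjoin.
  split; first exact: wedge_adjoin.
  by move=> x Wx WNx; case: (lineality_adjoin wW nWNy Wx WNx); apply: LW.
exact: sub_adjoin.
Qed.

(** * Archimedean classes and the cortege of a total wedge *)

Section TotalWedge.
Variable W : set Y.
Hypotheses (wedgeW : wedge W) (totalW : forall x, W x \/ W (- x)).

Let W0 : W 0. Proof. by case: wedgeW. Qed.
Let WD x y : W x -> W y -> W (x + y). Proof. by case: wedgeW => _ + _; apply. Qed.
Let WZ (l : R) x : 0 <= l -> W x -> W (l *: x).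
Proof. by case: wedgeW => _ _; apply. Qed.

(** Strict positivity: by totality it also implies [W e]. *)
Let pos (e : Y) : Prop := ~ W (- e).

Let posW e : pos e -> W e. Proof. by case: (totalW e). Qed.

Let pos_scale e r : pos e -> W (r *: e) -> 0 <= r.
Proof.
move=> pe Wre; rewrite leNgt; apply/negP => r0; apply: pe.
have -> : - e = (- r^-1) *: (r *: e).
  by rewrite scalerA mulNr mulVf ?lt_eqF // scaleN1r.
by apply: WZ => //; rewrite oppr_ge0 invr_le0 ltW.
Qed.

(* [W] is the nonnegative cone of a total preorder; since [r] may have any sign,
   these are the [z] with [|z|] below every positive multiple of [e]. *)
Definition infinitesimal (e : Y) : set Y := [set z | forall r : R, W (e + r *: z)].

(** For positive elements, the Archimedean class of [a] is at least that of [b]. *)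
Definition dominates (a b : Y) : Prop := exists r : R, W (r *: a - b).

Lemma subspace_infinitesimal e : pos e -> subspace (infinitesimal e).
Proof.
move=> pe; split=> [r|a x y ix iy r].
  by rewrite scaler0 addr0; apply: posW.
(* A midpoint of two elements of [W]. *)
have -> : e + r *: (a *: x + y) =
    2^-1 *: ((e + (2 * r * a) *: x) + (e + (2 * r) *: y)).
  rewrite addrACA -mulr2n -scaler_nat !scalerDr !scalerA !mulrA.
  by rewrite mulVf ?pnatr_eq0 // !mul1r scale1r.
by apply: WZ; [rewrite invr_ge0|apply: WD].
Qed.

Lemma not_infinitesimal_self e : pos e -> ~ infinitesimal e e.
Proof.
move=> pe /(_ (- 2)) We; apply: pe; suff <- : e + -2 *: e = - e by [].
rewrite -[X in X + _]scale1r -scalerDl -scaleN1r.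
by congr (_ *: _); rewrite opprD addNKr.
Qed.

Lemma lineality_infinitesimal e z : pos e -> W z -> W (- z) -> infinitesimal e z.
Proof.
move=> pe Wz WNz r; apply: WD; first exact: posW.
have [r0|r0] := leP 0 r; first exact: WZ.
by rewrite -[_ *: _]opprK -scaleNr -scalerN; apply: WZ => //; rewrite oppr_ge0 ltW.
Qed.

Lemma dominates_total a b : pos a -> pos b -> dominates a b \/ dominates b a.
Proof.
move=> pa pb; have [Wab|Wba] := totalW (a - b).
  by left; exists 1; rewrite scale1r.
by right; exists 1; rewrite scale1r -opprB.
Qed.

Lemma dominates_trans a b c :
  pos b -> pos c -> dominates a b -> dominates b c -> dominates a c.
Proof.
move=> pb pc [r Wab] [s Wbc].
have s0 : 0 <= s.
  by apply: (pos_scale pb); rewrite -[_ *: _](subrK c); apply: WD => //; apply: posW.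
exists (s * r); have -> : (s * r) *: a - c = s *: (r *: a - b) + (s *: b - c).
  by rewrite scalerBr scalerA addrA subrK.
by apply: WD => //; apply: WZ.
Qed.

(** If [e + r *: a] is not in [W], its opposite is, and the coefficient [- r] witnesses
    domination. *)
Lemma not_dominates_infinitesimal a e : ~ dominates a e -> infinitesimal e a.
Proof.
move=> nd r; have [//|We] := totalW (e + r *: a).
by case: nd; exists (- r); rewrite scaleNr addrC -opprD.
Qed.

Lemma infinitesimal_sub a b :
  pos a -> pos b -> dominates a b -> infinitesimal b `<=` infinitesimal a.
Proof.
move=> pa pb [r Wab] z iz t.
have r0 : 0 <= r.
  by apply: (pos_scale pa); rewrite -[_ *: _](subrK b); apply: WD => //; apply: posW.
have rN0 : r != 0.
  by apply/eqP => r_eq0; apply: pb; rewrite -sub0r -(scale0r a) -r_eq0.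
have -> : a + t *: z = r^-1 *: ((r *: a - b) + (b + (r * t) *: z)).
  by rewrite addrA subrK scalerDr !scalerA mulrA mulVf // scale1r mul1r.
by apply: WZ; [rewrite invr_ge0|apply: WD].
Qed.

(* The Archimedean property of [R] makes the quotient of the elements dominated
   by [e] by the infinitesimal ones a line. *)
Lemma dominates_line e a : pos e -> pos a -> dominates e a ->
  exists s : R, infinitesimal e (a - s *: e).
Proof.
move=> pe pa [r Wea].
(* The coefficient sought is the supremum of the [t] with [t *: e] below [a]; domination bounds it
   by [r]. *)
pose E := [set t : R | W (a - t *: e)].
have supE : has_sup E.
  split; first by exists 0; rewrite /E /= scale0r subr0; apply: posW.
  exists r => t Et; rewrite -subr_ge0; apply: (pos_scale pe).
  rewrite scalerBl -[r *: e](subrK a) -addrA; exact: WD.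
exists (sup E) => t; set d := a - _.
have dlo eps : 0 < eps -> W (eps *: e + d).
  move=> eps0; have [t' Et' ltt'] := sup_adherent eps0 supE.
  have -> : eps *: e + d = (a - t' *: e) + (t' - (sup E - eps)) *: e.
    rewrite /d [(t' - _) *: e]scalerBl subrKA scalerBl opprB.
    by rewrite addrCA.
  by apply: WD => //; apply: WZ; [rewrite subr_ge0 ltW|apply: posW].
have dhi eps : 0 < eps -> W (eps *: e - d).
  move=> eps0; have [Wd|] := totalW (a - (sup E + eps) *: e).
    have := sup_upper_bound supE Wd.
    by rewrite gerDl leNgt eps0.
  by rewrite /d !opprB scalerDl addrA [eps *: e + _]addrC.
(* For [t != 0], take [eps] to be the inverse of [|t|] in [dlo] or [dhi] and rescale by [|t|]. *)
clearbody d; have [t0|t0|->] := ltgtP t 0; last by rewrite scale0r addr0; apply: posW.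
- have -> : e + t *: d = (- t) *: ((- t)^-1 *: e - d).
    by rewrite scalerBr scalerA mulfV ?oppr_eq0 ?lt_eqF // scale1r scaleNr opprK.
  by apply: WZ; [rewrite oppr_ge0 ltW|apply: dhi; rewrite invr_gt0 oppr_gt0].
- have -> : e + t *: d = t *: (t^-1 *: e + d).
    by rewrite scalerDr scalerA mulfV ?gt_eqF // scale1r.
  by apply: WZ; [rewrite ltW|apply: dlo; rewrite invr_gt0].
Qed.

(** Modulo infinitesimals [a] is [s *: e] with [s = phi a], and [s <= 0] would make [a]
    infinitesimal with respect to [e]. So a functional chosen for one [e] serves every positive
    element with the same infinitesimals. *)
Lemma functional_pos (phi : {linear Y -> R^o}) e a : pos e -> pos a ->
  (forall z, infinitesimal e z -> phi z = 0) -> phi e = 1 ->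
  infinitesimal e = infinitesimal a -> 0 < phi a.
Proof.
move=> pe pa phi0 phi1 iea.
have nia : ~ infinitesimal e a by rewrite iea; apply: not_infinitesimal_self.
have nie : ~ infinitesimal a e by rewrite -iea; apply: not_infinitesimal_self.
have dea : dominates e a.
  by apply: contrapT => /not_dominates_infinitesimal.
have [s is_] := dominates_line pe pa dea.
have -> : phi a = s.
  apply/eqP; rewrite -subr_eq0; apply/eqP; rewrite -(phi0 _ is_).
  by rewrite linearB linearZ /= phi1 [_ *: _]mulr1.
rewrite ltNge; apply/negP => s0; apply: nia => r.
have [r0|r0] := leP 0 r.
  by apply: WD; [exact: posW|apply: WZ => //; apply: posW].
have -> : e + r *: a = (e + r *: (a - s *: e)) + (r * s) *: e.
  by rewrite scalerBr scalerA addrA subrK.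
by apply: WD => //; apply: WZ; [rewrite mulr_le0 // ltW|apply: posW].
Qed.

Lemma total_wedge_step_fun : exists F le, cortege F le /\
  forall y, [/\ ~ W (- y) -> 0 < step_fun F le y,
                ~ W y -> step_fun F le y < 0 &
                W y -> W (- y) -> step_fun F le y = 0].
Proof.
(* The choice depends on the set of infinitesimals and not on [e], so that elements of one
   Archimedean class share one functional; this makes [le] antisymmetric. *)
have [|Phi PhiP] := @choice (set Y) {linear Y -> R^o} (fun A phi =>
    forall e, pos e -> A = infinitesimal e ->
    (forall z, A z -> phi z = 0) /\ 0 < phi e).
  move=> A.
  have [[e [pe ->]]|nA] := pselect (exists e, pos e /\ A = infinitesimal e).
    have [phi [phi0 phi1]] := exists_linear_functional
      (subspace_infinitesimal pe) (not_infinitesimal_self pe).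
    exists phi => a pa iea; split=> //; exact: functional_pos iea.
  by exists \0 => e pe Ae; case: nA; exists e.
pose phi e := Phi (infinitesimal e).
have phi_gt0 e : pos e -> 0 < phi e e by move=> pe; have [] := PhiP _ _ pe erefl.
have phi0 e z : pos e -> infinitesimal e z -> phi e z = 0.
  by move=> pe iz; have [+ _] := PhiP _ _ pe erefl; apply.
have phi_dom e a : pos e -> pos a -> phi e a != 0 -> dominates a e.
  move=> pe pa; apply: contra_neqP => /not_dominates_infinitesimal.
  exact: phi0.
have phi_inj e a : pos e -> pos a -> phi e = phi a -> dominates a e.
  by move=> pe pa E; apply: phi_dom => //; rewrite E gt_eqF // phi_gt0.
have phi_eq e a : pos e -> pos a -> dominates e a -> dominates a e -> phi e = phi a.
  move=> pe pa dea dae; congr Phi.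
  by apply/seteqP; split; apply: infinitesimal_sub.
pose F := [set f | exists2 e, pos e & f = phi e].
pose le f g := exists a b, [/\ pos a, pos b, f = phi a, g = phi b & dominates a b].
have le_phi a b : pos a -> pos b -> le (phi a) (phi b) -> dominates a b.
  move=> pa pb [a' [b' [pa' pb' /esym/phi_inj aa' /phi_inj bb' dab]]].
  apply: (@dominates_trans _ a') => //; first exact: aa'.
  by apply: (@dominates_trans _ b') => //; apply: bb'.
(* If [phi b] does not vanish at [a], then [a] is not infinitesimal with respect to [b], hence
   dominates [b], and [phi a] comes first. *)
have least_pos y a : pos a -> a = y \/ a = - y ->
    is_least le (nonvanishing F y) (phi a).
  move=> pa aE.
  have nz f : (f : {linear Y -> R^o}) y != 0 = (f a != 0).
    by case: aE => -> //; rewrite linearN oppr_eq0.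
  split; first by split; [exists a|rewrite nz gt_eqF // phi_gt0].
  move=> _ [[b pb ->]]; rewrite nz => bn0.
  by exists a, b; split=> //; apply: phi_dom.
have corF : cortege F le.
  split.
  - split.
    + by move=> _ [a pa ->]; exists a, a; split=> //; case: (dominates_total pa pa).
    + move=> _ _ [a pa ->] [b pb ->] /le_phi ab /le_phi ba.
      by apply: phi_eq => //; [apply: ab|apply: ba].
    + move=> _ _ _ [a pa ->] [b pb ->] [c pc ->] /le_phi ab /le_phi bc.
      exists a, c; split=> //.
      by apply: (@dominates_trans _ b) => //; [apply: ab|apply: bc].
    + move=> _ _ [a pa ->] [b pb ->].
      by case: (dominates_total pa pb) => d; [left; exists a, b|right; exists b, a].
  - move=> y; have [py|] := pselect (pos y).
      by right; exists (phi y); apply: least_pos => //; left.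
    move=> /contrapT WNy; have [Wy|nWy] := pselect (W y).
      left; apply/seteqP; split=> // f [[a pa ->]] /eqP; apply.
      by apply: phi0 => //; apply: lineality_infinitesimal.
    have pNy : pos (- y) by rewrite /pos opprK.
    by right; exists (phi (- y)); apply: least_pos => //; right.
  - by move=> _ [a pa ->]; exists a; apply: least_pos => //; left.
exists F, le; split=> // y; split.
- move=> py; rewrite (step_fun_least corF (least_pos y y py _)); last by left.
  exact: phi_gt0.
- move=> nWy; have pNy : pos (- y) by rewrite /pos opprK.
  rewrite (step_fun_least corF (least_pos y (- y) pNy _)); last by right.
  by rewrite -oppr_gt0 -linearN phi_gt0.
- move=> Wy WNy; apply: step_fun0; apply/seteqP; split=> // f [[a pa ->]] /eqP; apply.
  by apply: phi0 => //; apply: lineality_infinitesimal.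
Qed.

End TotalWedge.
End Separation.

(** * The wedge of a compatible preference and separation *)

Section CompatiblePreference.
Variables (R : realType) (Y : lmodType R) (prec : Y -> Y -> Prop).
Hypotheses (prec_pref : partial_preference prec) (prec_compat : compatible prec).

Let P (x : Y) : Prop := prec 0 x.
Let I (x : Y) : Prop := ~ P x /\ ~ P (- x).
(** Translations preserving indifference to [0]; [equipotentE] identifies them with the elements
    equipotent to [0]. *)
Let L (h : Y) : Prop := forall x, I x <-> I (x + h).

Lemma prec_sub y z : prec y z <-> prec 0 (z - y).
Proof.
split=> [/prec_compat[_ /(_ (- y))]|/prec_compat[_ /(_ y)]].
  by rewrite subrr.
by rewrite add0r subrK.
Qed.

Let PD x y : P x -> P y -> P (x + y).
Proof.
move=> Px Py; apply: (prec_pref.2 _ y) => //.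
by rewrite prec_sub addrK.
Qed.

Let PZ (l : R) x : 0 < l -> P x -> P (l *: x).
Proof. by move=> l0 /prec_compat[/(_ l l0)]; rewrite scaler0. Qed.

Let PN x : P x -> ~ P (- x).
Proof.
move=> Px PNx; apply: (prec_pref.1 _ _ Px).
by rewrite prec_sub sub0r.
Qed.

Let I0 : I 0.
Proof. by rewrite /I oppr0; split=> P0; apply: (PN P0); rewrite oppr0. Qed.

Let IZ (l : R) x : 0 < l -> I (l *: x) <-> I x.
Proof.
move=> l0; have PZE y : P (l *: y) <-> P y.
  split; last exact: PZ.
  have lV0 : 0 < l^-1 by rewrite invr_gt0.
  by move=> /(PZ lV0); rewrite scalerA mulVf ?gt_eqF // scale1r.
by rewrite /I -scalerN !PZE.
Qed.

Let equipotentE y z : equipotent prec y z <-> L (z - y).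
Proof.
have indE x t : indifferent prec x t <-> I (t - x).
  by rewrite /indifferent (prec_sub x) (prec_sub t) /I opprB.
have sub_sub x : y - x + (z - y) = z - x by rewrite addrC addrA subrK.
split=> [E x|Lzy].
(* The point [y - x] differs from [y] by [x] and from [z] by [x + (z - y)]. *)
- have := congr1 (fun A : set Y => A (y - x)) E => /= Ex.
  have : I (y - (y - x)) <-> I (z - (y - x)) by rewrite -!indE Ex.
  by rewrite subKr opprB addrCA.
- apply/seteqP; split=> x /=; rewrite !indE -(sub_sub x); first exact: (Lzy _).1.
  exact: (Lzy _).2.
Qed.

Let L0 : L 0. Proof. by move=> x; rewrite addr0. Qed.

Let LI h : L h -> I h. Proof. by move=> /(_ 0) [/(_ I0)]; rewrite add0r. Qed.

Let LD h k : L h -> L k -> L (h + k).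
Proof. by move=> Lh Lk x; rewrite addrA (Lh x) (Lk (x + h)). Qed.

Let LN h : L h -> L (- h).
Proof. by move=> Lh x; rewrite (Lh (x - h)) subrK. Qed.

Let LZ (l : R) h : 0 < l -> L h -> L (l *: h).
Proof.
move=> l0 Lh x; have -> : x = l *: (l^-1 *: x).
  by rewrite scalerA mulfV ?gt_eqF // scale1r.
rewrite -scalerDr !(IZ _ l0); exact: Lh.
Qed.

(** If [p + h] is not positive, then either its opposite is, and adding [p] gives [P (- h)] although
    [h] is indifferent to [0]; or [p + h] is indifferent to [0], and then so is [p]. *)
Let PLD p h : P p -> L h -> P (p + h).
Proof.
move=> Pp Lh; apply: contrapT => nP; have [nPh nPNh] := LI Lh.
have [PN_ph|nPN] := pselect (P (- (p + h))).
  by apply: nPNh; have := PD Pp PN_ph; rewrite opprD addNKr.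
by have [/(_ Pp)] := (Lh p).2 (conj nP nPN).
Qed.

Let W0 : set Y := [set x | P x \/ L x].

Let wedgeW0 : wedge W0.
Proof.
split; first by right.
- move=> x y [Px|Lx] [Py|Ly]; [left|left|left|right].
  + exact: PD.
  + exact: PLD.
  + by rewrite addrC; apply: PLD.
  + exact: LD.
- move=> l x; rewrite le_eqVlt => /predU1P[<- _|l0 [Px|Lx]].
  + by rewrite scale0r; right.
  + by left; apply: PZ.
  + by right; apply: LZ.
Qed.

Let linealityW0 x : W0 x -> W0 (- x) -> L x.
Proof.
move=> [Px|//] [PNx|/LN]; last by rewrite opprK.
by case: (PN Px).
Qed.

Lemma equipotent_sub y z : equipotent prec y z <-> equipotent prec 0 (z - y).
Proof. by rewrite !equipotentE subr0. Qed.

Lemma exists_separating x : ~ prec 0 x ->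
  exists2 u, step_linear_family prec u &
    u x <= 0 /\ (u x = 0 -> equipotent prec 0 x).
Proof.
move=> nPx.
suff [u uU [ux uL]] : exists2 u, step_linear_family prec u &
    u x <= 0 /\ (u x = 0 -> L x).
  by exists u => //; split=> // /uL; rewrite equipotentE subr0.
(* When [x] is not in [L], it lies outside [W0], so adjoining [- x] keeps the lineality space inside
   [L] and forces [u x < 0] later. *)
have [V [wV sV LV V_x]] : exists V, [/\ wedge V, W0 `<=` V,
    forall y, V y -> V (- y) -> L y & L x \/ V (- x)].
  have [Lx|nLx] := pselect (L x); first by exists W0; split=> //; left.
  have nW0 : ~ W0 (- - x) by rewrite opprK => -[].
  exists (adjoin W0 (- x)); split.
  - exact: wedge_adjoin.
  - exact: sub_adjoin.
  - by move=> y Vy VNy; case: (lineality_adjoin wedgeW0 nW0 Vy VNy); apply: linealityW0.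
  - by right; apply: mem_adjoin.
have [W [wW sW totW LW]] := exists_total_wedge wV LV.
have [F [le [corF uP]]] := total_wedge_step_fun wW totW.
have LWW h : L h -> W h /\ W (- h).
  by move=> Lh; split; apply/sW/sV; right=> //; apply: LN.
have u_pos y : P y -> 0 < step_fun F le y.
  move=> Py; have [+ _ _] := uP y; apply => WNy.
  have /LI[+ _] : L y by apply: LW => //; apply/sW/sV; left.
  exact.
have u0 h : L h -> step_fun F le h = 0.
  by move=> /LWW[Wh WNh]; case: (uP h) => _ _; apply.
exists (step_fun F le).
  split; first by exists F, le.
  by move=> y z; rewrite prec_sub equipotentE; split; [apply: u_pos|apply: u0].
have [Lx|nLx] := pselect (L x); first by rewrite u0.
case: V_x => // VNx; have [_ u_neg _] := uP x.
have /u_neg ux : ~ W x by move=> Wx; apply: nLx; apply: LW => //; apply: sW.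
by split; [exact: ltW|move=> ux0; rewrite ux0 ltxx in ux].
Qed.

End CompatiblePreference.

Theorem theorem6p4 (R : realType) (Y : lmodType R) (prec : Y -> Y -> Prop)
    (prec_pref : partial_preference prec) (prec_compat : compatible prec) :
  step_linear_family prec !=set0 /\
  (forall y z : Y,
     (prec y z <-> forall u, step_linear_family prec u -> 0 < u (z - y)) /\
     (equipotent prec y z <->
        forall u, step_linear_family prec u -> u (z - y) = 0)).
Proof.
have prec_subE := prec_sub prec_compat.
have sep := exists_separating prec_pref prec_compat.
have nP0 : ~ prec 0 0 by move=> P0; apply: (prec_pref.1 _ _ P0).
have ne : step_linear_family prec !=set0.
  (* Separation at [0] already yields a member. *)
  by have [u uU _] := sep _ nP0; exists u.
split=> // y z; split; split.
- by move=> yz u [_ /(_ y z)[+ _]]; apply.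
- move=> u_pos; rewrite prec_subE; apply: contrapT => /sep[u /u_pos + [+ _]].
  by rewrite leNgt => ->.
- by move=> yz u [_ /(_ y z)[_]]; apply.
- move=> u_0; rewrite (equipotent_sub prec_compat).
  (* If [z - y] were positive, any member of the nonempty family would be positive there, not
     zero. *)
  have [Pzy|/sep[u /u_0 uzy [_ /(_ uzy)]]//] := pselect (prec 0 (z - y)).
  have [u uU] := ne; have [_ /(_ y z)[+ _]] := uU.
  by rewrite prec_subE => /(_ Pzy); rewrite u_0 ?ltxx.
Qed.
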